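(* Let $F:\Omega\to\mathbb R$, $F(x)=\sum_{(i,j)\in\mathcal E}f_{i,j}(x_i,x_j)$, be a sum of bivariates on $\Omega=\Omega_1\times\dots\times\Omega_n$ with a unique minimizer $x^*\in\Omega$. (Global relaxation) The problem $\min_{\mu\in\mathcal M_1^+(\Omega)}\langle F,\mu\rangle$ has minimal value $\min_{x\in\Omega}F(x)$, and its unique minimizer is the Dirac measure $\delta_{x^*}$. (Tree relaxation) If moreover $\mathcal G=(\mathcal V,\mathcal E)$ is a tree, then the problem $$\min\ \sum_{(i,j)\in\mathcal E}\langle f_{i,j},\mu_{i,j}\rangle\quad\text{over } \mu_{i,j}\in\mathcal M^+(\Omega_i\times\Omega_j)\ ((i,j)\in\mathcal E),\ \mu_i\in\mathcal M_1^+(\Omega_i)\ (i\in\mathcal V),$$ $$\text{s.t. } \mu_i=\mu_{i,j}\circ\pi_i^{-1}\ \text{ and }\ \mu_j=\mu_{i,j}\circ\pi_j^{-1}\quad\text{for all }(i,j)\in\mathcal E,$$ has minimal value $\min_{x\in\Omega}F(x)$, and its unique minimizer is $\mu_{i,j}=\delta_{(x_i^*,x_j^* )}$ for $(i,j)\in\mathcal E$, $\mu_i=\delta_{x_i^*}$ for $i\in\mathcal V$. (Star relaxation) If moreover $\mathcal G$ is a star graph with root $i^*\in\mathcal V$ and $\mathcal E=\mathcal N(i^* )$, then the problem $$\min\ \sum_{(i^*,j)\in\mathcal N(i^* )}\langle f_{i^*,j},\mu_{i^*,j}\rangle\quad\text{over } \mu_{i^*,j}\in\mathcal M^+(\Omega_{i^*}\times\Omega_j)\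 ((i^*,j)\in\mathcal N(i^* )),\ \mu_{i^*}\in\mathcal M_1^+(\Omega_{i^*}),$$ $$\text{s.t. } \mu_{i^*}=\mu_{i^*,j}\circ\pi_{i^*}^{-1}\quad\text{for all }(i^*,j)\in\mathcal N(i^* ),$$ has minimal value $\min_{x\in\Omega}F(x)$, and its unique minimizer is $\mu_{i^*,j}=\delta_{(x_{i^*}^*,x_j^* )}$ for $(i^*,j)\in\mathcal N(i^* )$, $\mu_{i^*}=\delta_{x_{i^*}^*}$.
   Context: $\mathcal V=\{1,\dots,n\}$; $\Omega_1,\dots,\Omega_n$ are finite nonempty sets. $\mathcal E$ is a set of edges on $\mathcal V$, each edge written once as an ordered pair ($i<j$; in a rooted tree or star the parent is written first); $f_{i,j}:\Omega_i\times\Omega_j\to\mathbb R$. $\mathcal N(i)=\{(i,j)\in\mathcal E\}$ is the set of edges with first entry $i$. $\mathcal M^+(X)$ denotes the (nonnegative finite) measures and $\mathcal M_1^+(X)$ the probability measures on a finite set $X$ with its power set; $\langle f,\mu\rangle=\int f\,d\mu$; $\pi_i$ is the projection to the $i$-th coordinate, so $\mu_{i,j}\circ\pi_i^{-1}$ is the marginal on $\Omega_i$. *)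

(* Defs.v *)
From HB Require Import structures.
From mathcomp Require Import all_boot all_order all_algebra.
From mathcomp Require Import all_classical all_reals all_analysis.

Set Implicit Arguments.
Unset Strict Implicit.
Unset Printing Implicit Defensive.

Import Order.TTheory GRing.Theory Num.Theory.

Local Open Scope classical_set_scope.
Local Open Scope ring_scope.

(* Finite nonempty sets. The base point only witnesses nonemptiness (it is
   required by [measurableType]); no definition below depends on its value. *)
#[short(type="finPointedType")]
HB.structure Definition FinPointed := {T of Finite T & Pointed T}.

#[warning="-redundant-canonical-projection"]
HB.instance Definition _ (T1 T2 : finPointedType) :=
  Pointed.on (T1 * T2)%type.

HB.instance Definition _ (I : finType) (T : I -> finPointedType) :=
  isPointed.Build {dffun forall i : I, T i}
    (finfun (fun i : I => point : T i)).

(* [power T] is T with its power set as sigma-algebra. In particular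
   [power (T1 * T2)] avoids the product sigma-algebra that the library puts
   on pairs of measurable types. *)
Definition power (T : finPointedType) : Type := T.
HB.instance Definition _ (T : finPointedType) := FinPointed.on (power T).
#[warning="-redundant-canonical-projection"]
HB.instance Definition _ (T : finPointedType) :=
  @isMeasurable.Build default_measure_display (power T)
    discrete_measurable discrete_measurable0
    discrete_measurableC discrete_measurableU.

Section Measures.
Variable R : realType.

Definition Mplus (T : finPointedType) := {finite_measure set (power T) -> \bar R}.
Definition Mprob (T : finPointedType) := probability (power T) R.

Definition pairing (T : finPointedType) (f : T -> R)
    (mu : {measure set (power T) -> \bar R}) : \bar R :=
  (\int[mu]_x (f x)%:E)%E.

(* Image measures [mu \o fst^-1] and [mu \o snd^-1], as set functions. *)
Definition marginal1 (T1 T2 : finPointedType) (mu : Mplus (T1 * T2)%type) :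
    set (power T1) -> \bar R :=
  pushforward mu (fst : power (T1 * T2)%type -> power T1).
Definition marginal2 (T1 T2 : finPointedType) (mu : Mplus (T1 * T2)%type) :
    set (power T2) -> \bar R :=
  pushforward mu (snd : power (T1 * T2)%type -> power T2).

Definition delta (T : finPointedType) (x : T) : Mplus T := dirac (x : power T).
Definition delta1 (T : finPointedType) (x : T) : Mprob T := dirac (x : power T).

End Measures.

Section Optimization.
Context {d : Order.disp_t} {X : Type} {Y : porderType d}.
Variables (feasible : set X) (obj : X -> Y).

Definition minimizer (x : X) : Prop :=
  feasible x /\ forall y, feasible y -> (obj x <= obj y)%O.

Definition unique_minimizer (x : X) : Prop :=
  minimizer x /\ forall y, minimizer y -> y = x.

Definition minimal_value (v : Y) : Prop :=
  exists2 x, minimizer x & obj x = v.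

End Optimization.

Section Graphs.
Variables (n : nat) (E : {set 'I_n * 'I_n}).

(* Each edge {i, j}, i != j, is represented by exactly one of (i, j), (j, i);
   this covers both i < j and "parent first". *)
Definition edges_once : Prop :=
  forall i j : 'I_n, (i, j) \in E -> i != j /\ (j, i) \notin E.

Definition adjacent : rel 'I_n :=
  fun i j => ((i, j) \in E) || ((j, i) \in E).

(* Nonempty, connected, and without simple cycles of length at least 3. *)
Definition is_tree : Prop :=
  [/\ (0 < n)%N, forall i j : 'I_n, connect adjacent i j
    & forall c : seq 'I_n, ucycle adjacent c -> (size c <= 2)%N].

Definition is_star (r : 'I_n) : Prop :=
  forall i j : 'I_n, adjacent i j = (i != j) && ((i == r) || (j == r)).

Definition out_edges (i : 'I_n) : {set 'I_n * 'I_n} := [set e in E | e.1 == i].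

Definition edge := {e : 'I_n * 'I_n | e \in E}.
Definition src (e : edge) : 'I_n := (val e).1.
Definition tgt (e : edge) : 'I_n := (val e).2.

(* The edges (r, j) starting at r, each represented by its second entry j. *)
Definition leaf (r : 'I_n) := {j : 'I_n | (r, j) \in out_edges r}.

End Graphs.

Section Relaxations.
Variables (R : realType) (n : nat) (Omega : 'I_n -> finPointedType).
Variable E : {set 'I_n * 'I_n}.
(* Only the functions f i j with (i, j) \in E are ever used. *)
Variable f : forall i j : 'I_n, Omega i -> Omega j -> R.

Definition config : finPointedType := {dffun forall i : 'I_n, Omega i}.

Definition bivariate_sum (x : config) : R :=
  \sum_(e in E) f (x e.1) (x e.2).

Definition biv (i j : 'I_n) (z : (Omega i * Omega j)%type) : R := f z.1 z.2.

Definition global_objective (mu : Mprob R config) : \bar R :=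
  pairing bivariate_sum mu.

Definition tree_variable : Type :=
  ((forall e : edge E, Mplus R (Omega (src e) * Omega (tgt e))%type) *
   (forall i : 'I_n, Mprob R (Omega i)))%type.

Definition tree_objective (v : tree_variable) : \bar R :=
  (\sum_(e : edge E) pairing (@biv (src e) (tgt e)) (v.1 e))%E.

Definition tree_feasible : set tree_variable :=
  [set v : tree_variable | forall e : edge E,
     v.2 (src e) = marginal1 (v.1 e) :> (set _ -> \bar R) /\
     v.2 (tgt e) = marginal2 (v.1 e) :> (set _ -> \bar R)].

Definition tree_dirac (x : config) : tree_variable :=
  (fun e => delta R (x (src e), x (tgt e)), fun i => delta1 R (x i)).

Variable r : 'I_n.

Definition star_variable : Type :=
  ((forall j : leaf E r, Mplus R (Omega r * Omega (val j))%type) *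
   Mprob R (Omega r))%type.

Definition star_objective (v : star_variable) : \bar R :=
  (\sum_(j : leaf E r) pairing (@biv r (val j)) (v.1 j))%E.

Definition star_feasible : set star_variable :=
  [set v : star_variable | forall j : leaf E r,
     v.2 = marginal1 (v.1 j) :> (set _ -> \bar R)].

Definition star_dirac (x : config) : star_variable :=
  (fun j => delta R (x r, x (val j)), delta1 R (x r)).

End Relaxations.

(* Main.v *)
Require Import Defs.
From HB Require Import structures.
From mathcomp Require Import all_boot all_order all_algebra.
From mathcomp Require Import all_classical all_reals all_analysis.

Set Implicit Arguments.
Unset Strict Implicit.
Unset Printing Implicit Defensive.

Import Order.TTheory GRing.Theory Num.Theory.

Local Open Scope classical_set_scope.
Local Open Scope ring_scope.

(** A measure on a finite set with its power set is a vector of nonnegative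
weights, and integrals against it are finite weighted sums. On the whole of
[Omega] the statement is then the remark that a weighted average
[\sum_x P x * F x] with [P >= 0] and [\sum_x P x = 1] is at least [F x^*], with
equality only if [P] charges nothing but the unique minimizer
([expectation_min]).

The tree and star relaxations reduce to this case, because every feasible point
consists of marginals of some joint probability [P] on [Omega]
([tree_glue], [star_glue]). The objective of the relaxation is then
[\sum_x P x * F x], so that it is bounded below by [F x^*], and equality forces
[P], hence all of its marginals, to be Dirac measures.

The joint probability is built one vertex at a time as a Markov chain along the
graph. Let [P] have the prescribed marginals on a vertex set [S], let [v] be
outside [S] and adjacent to [u] in [S]. Coordinate [v] of a [P]-random
configuration is redrawn from the conditional law given by
[mu_{u,v}(x_u, .) / mu_u(x_u)]. This gives the pair [(x_u, x_v)] the law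
[mu_{u,v}] and leaves the law of the other coordinates unchanged ([resample]).
In a tree [S] can be kept connected, and then acyclicity makes [u] the only
neighbour of [v] in [S] ([unique_neighbour]), so that no other edge constrains
[x_v]. In a star every leaf is attached to the root, and the leaves are
added in any order. *)

(** * Weighted averages on finite sets *)

Lemma sum_pick (R : realType) (T : finType) (z : T) (g : T -> R) :
  \sum_t (t == z)%:R * g t = g z.
Proof.
rewrite (bigD1 z) //= eqxx mul1r big1 ?addr0 // => t /negbTE ->.
by rewrite mul0r.
Qed.

Lemma sum_prod (R : realType) (A B : finType) (h : A * B -> R) :
  \sum_z h z = \sum_a \sum_b h (a, b).
Proof. by rewrite pair_bigA; apply: eq_bigr => -[]. Qed.

Lemma expectation_min (R : realType) (T : finType) (F P : T -> R) (x0 : T) :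
    (forall x, 0 <= P x) -> \sum_x P x = 1 ->
    (forall x, F x0 <= F x) -> (forall x, F x = F x0 -> x = x0) ->
  F x0 <= \sum_x P x * F x /\
  (\sum_x P x * F x = F x0 -> forall x, P x = (x == x0)%:R).
Proof.
move=> P0 P1 Fmin Funi.
have gap : \sum_x P x * F x - F x0 = \sum_x P x * (F x - F x0).
  under [RHS]eq_bigr do rewrite mulrBr.
  by rewrite sumrB -mulr_suml P1 mul1r.
have term0 x : 0 <= P x * (F x - F x0) by rewrite mulr_ge0 ?subr_ge0.
split; first by rewrite -subr_ge0 gap sumr_ge0.
move=> /eqP; rewrite -subr_eq0 gap psumr_eq0 // => /allP PF.
have Pnull x : x != x0 -> P x = 0.
  move=> xx0; have := PF x; rewrite mem_index_enum mulf_eq0 subr_eq0.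
  by move=> /(_ isT)/orP[/eqP//|/eqP/Funi xx]; rewrite xx eqxx in xx0.
move=> x; have [->|/Pnull//] := eqVneq x x0.
by rewrite -P1 (bigD1 x0) //= [X in _ + X]big1 ?addr0 // => y /Pnull.
Qed.

(** * Gluing marginals into a joint distribution *)

Section Gluing.
Variables (R : realType) (n : nat) (Omega : 'I_n -> finPointedType).
Implicit Types (x y : config Omega) (P : config Omega -> R).

(** The configuration [x] with its coordinate [i] replaced by [a]. *)
Definition update x (i : 'I_n) (a : Omega i) : config Omega :=
  finfun (dfwith x i a).

Lemma update_same x (i : 'I_n) (a : Omega i) : update x a i = a.
Proof. by rewrite /update ffunE dfwithin. Qed.

Lemma update_other x (i j : 'I_n) (a : Omega i) : i != j -> update x a j = x j.
Proof. by move=> ij; rewrite /update ffunE dfwithout. Qed.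

(** Redrawing coordinate [v] from the conditional law [k a . / p a] given
[x u = a]. Observables [g] that do not depend on coordinate [v] keep their
expectation. *)
Lemma resample (u v : 'I_n) P (p : Omega u -> R) (k : Omega u -> Omega v -> R) :
    u != v -> (forall x, 0 <= P x) -> (forall a b, 0 <= k a b) ->
    (forall a, \sum_b k a b = p a) ->
    (forall g : Omega u -> R, \sum_x P x * g (x u) = \sum_a p a * g a) ->
  exists P', [/\ forall x, 0 <= P' x,
    forall g : config Omega -> R, (forall x (b : Omega v), g (update x b) = g x) ->
      \sum_x P' x * g x = \sum_x P x * g x
  & forall g : Omega u -> Omega v -> R,
      \sum_x P' x * g (x u) (x v) = \sum_a \sum_b k a b * g a b].
Proof.
move=> uv P0 k0 kp Pp.
have p0 a : 0 <= p a by rewrite -kp sumr_ge0.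
(* Where [p a = 0], [k a . / p a] is identically [0] instead of a conditional law;
   this is harmless because [P] and [k a .] vanish there. *)
have Pnull y : p (y u) = 0 -> P y = 0.
  move=> py; have /eqP : \sum_x P x * (x u == y u)%:R = 0.
    rewrite (Pp (fun a => (a == y u)%:R)) (eq_bigr (fun a => (a == y u)%:R * p a)).
      by rewrite sum_pick.
    by move=> a _; rewrite mulrC.
  rewrite psumr_eq0 => [/allP/(_ y)|x _]; last by rewrite mulr_ge0.
  by rewrite mem_index_enum eqxx mulr1 => /(_ isT)/eqP.
have knull a b : p a = 0 -> k a b = 0.
  rewrite -kp => /eqP; rewrite psumr_eq0 // => /allP/(_ b).
  by rewrite mem_index_enum => /(_ isT)/eqP.
pose c y b := P y * (k (y u) b / p (y u)).
pose P' x := \sum_y \sum_b c y b * (x == update y b)%:R.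
have E g : \sum_x P' x * g x = \sum_y \sum_b c y b * g (update y b).
  under eq_bigr do rewrite /P' mulr_suml.
  rewrite exchange_big; apply: eq_bigr => y _ /=.
  under eq_bigr do rewrite mulr_suml.
  rewrite exchange_big; apply: eq_bigr => b _ /=.
  under eq_bigr do rewrite -mulrA.
  by rewrite -mulr_sumr sum_pick.
exists P'; split.
- move=> x; apply: sumr_ge0 => y _; apply: sumr_ge0 => b _.
  by rewrite !mulr_ge0 ?invr_ge0.
- move=> g gv; rewrite E; apply: eq_bigr => y _.
  under eq_bigr do rewrite gv.
  rewrite -mulr_suml -mulr_sumr; congr (_ * _).
  rewrite -mulr_suml kp.
  have [/Pnull ->|py] := eqVneq (p (y u)) 0; first by rewrite mul0r.
  by rewrite divff ?mulr1.
- move=> g; rewrite (E (fun x => g (x u) (x v))).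
  pose h a := \sum_b k a b / p a * g a b.
  rewrite (eq_bigr (fun y => P y * h (y u))) => [|y _]; last first.
    rewrite /h mulr_sumr; apply: eq_bigr => b _.
    by rewrite update_same update_other 1?eq_sym // /c -mulrA.
  rewrite Pp; apply: eq_bigr => a _; rewrite mulr_sumr; apply: eq_bigr => b _.
  have [pa|pa] := eqVneq (p a) 0; first by rewrite pa knull ?mul0r.
  by rewrite mulrA mulrCA divff ?mulr1.
Qed.

(** The starting point of the gluing: coordinate [i] has law [p] and the other
coordinates are fixed at an arbitrary value. *)
Lemma lift_marginal (i : 'I_n) (p : Omega i -> R) : (forall a, 0 <= p a) ->
  exists P, (forall x, 0 <= P x) /\
    forall g : Omega i -> R, \sum_x P x * g (x i) = \sum_a p a * g a.
Proof.
move=> p0; pose x0 : config Omega := point.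
exists (fun x => \sum_a p a * (x == update x0 a)%:R); split => [x|g].
  by apply: sumr_ge0 => a _; rewrite mulr_ge0.
under eq_bigr do rewrite mulr_suml.
rewrite exchange_big; apply: eq_bigr => a _ /=.
under eq_bigr do rewrite -mulrA.
by rewrite -mulr_sumr (sum_pick _ (fun x => g (x i))) update_same.
Qed.

(** Marginal constraints are expressed through test functions [g], so that
product and one-vertex marginals have the same form. *)
Lemma star_glue (J : finType) (r : 'I_n) (t : J -> 'I_n)
    (p : Omega r -> R) (q : forall j, Omega r * Omega (t j) -> R) :
    injective t -> (forall j, r != t j) ->
    (forall a, 0 <= p a) -> (forall j z, 0 <= q j z) ->
    (forall j a, \sum_b q j (a, b) = p a) ->
  exists P, [/\ forall x, 0 <= P x,
    forall g : Omega r -> R, \sum_x P x * g (x r) = \sum_a p a * g a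
  & forall j (g : Omega r * Omega (t j) -> R),
      \sum_x P x * g (x r, x (t j)) = \sum_z q j z * g z].
Proof.
move=> tinj rt p0 q0 qp.
suff [P [P0 Pr Pt]] : exists P, [/\ forall x, 0 <= P x,
    forall g : Omega r -> R, \sum_x P x * g (x r) = \sum_a p a * g a
  & forall j, j \in enum J -> forall (g : Omega r * Omega (t j) -> R),
      \sum_x P x * g (x r, x (t j)) = \sum_z q j z * g z].
  by exists P; split=> // j; apply: Pt; rewrite mem_enum.
have : uniq (enum J) by exact: enum_uniq.
elim: (enum J) => [_|j s IH /= /andP[js us]].
  by have [P [P0 Pr]] := lift_marginal p0; exists P.
have [P [P0 Pr Ps]] := IH us.
have [P' [P'0 P'v P't]] := resample (rt j) P0 (fun a b => q0 j (a, b)) (qp j) Pr.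
exists P'; split=> // [g|i].
  by rewrite (P'v (fun x => g (x r))) // => x b; rewrite update_other // eq_sym.
rewrite inE; have [-> _ g|ij /= iS g] := eqVneq i j.
  by rewrite (P't (fun a b => g (a, b))) sum_prod.
rewrite (P'v (fun x => g (x r, x (t i)))) ?Ps // => x b.
by rewrite !update_other 1?eq_sym // (inj_eq tinj).
Qed.

Section Tree.
Variable E : {set 'I_n * 'I_n}.
Hypotheses (hE : edges_once E) (tE : is_tree E).
Variables (p : forall i, Omega i -> R)
  (q : forall e : edge E, Omega (src e) * Omega (tgt e) -> R).
Arguments p : clear implicits.
Arguments q : clear implicits.
Hypotheses (p0 : forall i a, 0 <= p i a) (q0 : forall e z, 0 <= q e z).
Hypotheses (qsrc : forall e a, \sum_b q e (a, b) = p (src e) a)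
  (qtgt : forall e b, \sum_a q e (a, b) = p (tgt e) b).

(** [P] has the prescribed marginals on the vertices in [S] and on the edges with
both ends in [S]. Its coordinates outside [S] are arbitrary. *)
Definition glued (S : {set 'I_n}) P : Prop :=
  [/\ forall x, 0 <= P x,
    forall i, i \in S -> forall g : Omega i -> R,
      \sum_x P x * g (x i) = \sum_a p i a * g a
  & forall e, src e \in S -> tgt e \in S ->
      forall g : Omega (src e) * Omega (tgt e) -> R,
      \sum_x P x * g (x (src e), x (tgt e)) = \sum_z q e z * g z].

(** Adjacency in the subgraph induced by [S]. *)
Definition inside (S : {set 'I_n}) : rel 'I_n :=
  fun i j => [&& Defs.adjacent E i j, i \in S & j \in S].

Lemma adjacent_sym i j : Defs.adjacent E i j = Defs.adjacent E j i.
Proof. by rewrite /Defs.adjacent orbC. Qed.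

Lemma adjacent_edge (e : edge E) : Defs.adjacent E (src e) (tgt e).
Proof. by case: e => -[i j] /= ij; rewrite /Defs.adjacent /src /tgt /= ij. Qed.

Lemma edge_inj (e e' : edge E) : src e = src e' -> tgt e = tgt e' -> e = e'.
Proof. by case: e e' => -[i j] ? [[i' j'] ?] /= ? ?; apply/val_inj; congr pair. Qed.

Lemma edge_flip (e e' : edge E) : src e = tgt e' -> tgt e = src e' -> False.
Proof.
case: e e' => -[i j] ij [[i' j'] ij']; rewrite /src /tgt /= => ? ?; subst.
by have [_ /negP] := hE ij.
Qed.

Lemma edge_neq (e : edge E) : src e != tgt e.
Proof. by case: e => -[i j] ij; have [] := hE ij. Qed.

(** Two neighbours [u != u'] of [v] would be joined by a simple path in [S],
which [v] closes to a cycle of length at least 3. *)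
Lemma unique_neighbour (S : {set 'I_n}) u u' v :
  (forall i j, i \in S -> j \in S -> connect (inside S) i j) ->
  u \in S -> u' \in S -> v \notin S -> Defs.adjacent E u v -> Defs.adjacent E u' v -> u = u'.
Proof.
move=> cS uS u'S vS uv u'v; apply/eqP/negP => uu'.
have /connectP[s0 s0p us0] := cS _ _ uS u'S.
move: us0; case/shortenP: s0p => s sp us _ u's {s0}.
case: tE => _ _ /(_ (v :: u :: s)) H.
have allS : {subset u :: s <= S}.
  move=> i; rewrite inE => /predU1P[->//|].
  elim: (s) (u) sp => //= j s' IH i0 /andP[/and3P[_ _ jS] jp].
  by rewrite inE => /predU1P[->//|]; exact: IH jp.
suff /H : ucycle (Defs.adjacent E) (v :: u :: s).
  by case: (s) u's => // u'u; rewrite u'u eqxx in uu'.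
rewrite /ucycle /= rcons_path -u's u'v adjacent_sym uv /=; apply/andP; split.
  by rewrite andbT; apply: sub_path sp => i j /and3P[].
apply/andP; split=> //; apply/negP => /allS; exact/negP.
Qed.

Lemma connect_grow (S : {set 'I_n}) u v :
  (forall i j, i \in S -> j \in S -> connect (inside S) i j) ->
  u \in S -> Defs.adjacent E u v ->
  forall i j, i \in v |: S -> j \in v |: S -> connect (inside (v |: S)) i j.
Proof.
move=> cS uS uv.
have sub : subrel (inside S) (connect (inside (v |: S))).
  move=> i j /and3P[ij iS jS]; apply: connect1.
  by rewrite /inside ij !inE iS jS !orbT.
have toS i : i \in v |: S -> connect (inside (v |: S)) i u.
  rewrite !inE => /predU1P[->|iS]; last exact: connect_sub sub _ _ (cS _ _ iS uS).
  by apply: connect1; rewrite /inside adjacent_sym uv !inE eqxx uS orbT.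
have fromS i : i \in v |: S -> connect (inside (v |: S)) u i.
  rewrite !inE => /predU1P[->|iS]; last exact: connect_sub sub _ _ (cS _ _ uS iS).
  by apply: connect1; rewrite /inside uv !inE eqxx uS orbT.
by move=> i j /toS iu /fromS uj; exact: connect_trans iu uj.
Qed.

(** A path from [S] to its complement leaves [S] along some edge. *)
Lemma exit_edge (S : {set 'I_n}) : S != finset.set0 -> S != [set: 'I_n]%SET ->
  exists u v, [/\ u \in S, v \notin S & Defs.adjacent E u v].
Proof.
move=> /set0Pn[i iS]; rewrite -properT => /properP[_ [j _ jS]].
case: tE => _ /(_ i j) /connectP[s + js] _.
elim: s i iS js => [i iS ji|k s IH i iS js /= /andP[ik ks]].
  by rewrite ji iS in jS.
have [kS|kS] := boolP (k \in S); first exact: IH kS js ks.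
by exists i, k.
Qed.

Lemma glue_step (S : {set 'I_n}) P u v :
  (forall i j, i \in S -> j \in S -> connect (inside S) i j) ->
  glued S P -> u \in S -> v \notin S -> Defs.adjacent E u v ->
  exists P', glued (v |: S) P'.
Proof.
move=> cS [P0 Pi Pe] uS vS uv.
have vNS i : i \in S -> v != i by move=> iS; apply: contraNneq vS => ->.
(* [e0] is the edge between [u] and [v], in either orientation; it is the only
   edge of [v |: S] with an end outside [S]. *)
have key (e0 : edge E) P' : (src e0, tgt e0) = (u, v) \/ (src e0, tgt e0) = (v, u) ->
    (forall x, 0 <= P' x) ->
    (forall g : config Omega -> R, (forall x (b : Omega v), g (update x b) = g x) ->
      \sum_x P' x * g x = \sum_x P x * g x) ->
    (forall g : Omega (src e0) * Omega (tgt e0) -> R,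
      \sum_x P' x * g (x (src e0), x (tgt e0)) = \sum_z q e0 z * g z) ->
    glued (v |: S) P'.
  move=> e0uv P'0 P'v P'e; split=> // [i|e].
    rewrite !inE => /predU1P[->|iS] g; last first.
      by rewrite (P'v (fun x => g (x i))) ?Pi // => x b; rewrite update_other ?vNS.
    case: e0uv => -[eu ev].
    + subst u v; rewrite (P'e (fun z => g z.2)) sum_prod.
      rewrite exchange_big; apply: eq_bigr => b _ /=.
      by rewrite -mulr_suml qtgt.
    + subst u v; rewrite (P'e (fun z => g z.1)) sum_prod.
      by apply: eq_bigr => b _ /=; rewrite -mulr_suml qsrc.
  have [se|se] := boolP (src e \in S); have [te|te] := boolP (tgt e \in S).
  - move=> _ _ g; rewrite (P'v (fun x => g (x (src e), x (tgt e)))) ?Pe // => x b.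
    by rewrite !update_other ?vNS.
  - move=> _; rewrite !inE (negbTE te) orbF => /eqP tv.
    have su : src e = u.
      apply: (unique_neighbour cS se uS vS _ uv); rewrite -tv; exact: adjacent_edge.
    case: e0uv => -[eu ev].
      suff -> : e = e0 by exact: P'e.
      by apply: edge_inj; rewrite ?su ?tv.
    by case: (@edge_flip e e0); rewrite ?su ?tv.
  - rewrite !inE (negbTE se) orbF => /eqP sv _.
    have tu : tgt e = u.
      apply: (unique_neighbour cS te uS vS _ uv); rewrite -sv adjacent_sym.
      exact: adjacent_edge.
    case: e0uv => -[eu ev].
      by case: (@edge_flip e e0); rewrite ?tu ?sv.
    suff -> : e = e0 by exact: P'e.
    by apply: edge_inj; rewrite ?tu ?sv.
  - rewrite !inE (negbTE se) (negbTE te) !orbF => /eqP sv /eqP tv.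
    by have /eqP[] := edge_neq e; rewrite sv tv.
case/orP: uv => uvE.
- pose e0 : edge E := exist _ (u, v) uvE.
  have [P' [P'0 P'v P'e]] := @resample u v P (p u) (fun a b => q e0 (a, b))
    (edge_neq e0) P0 (fun a b => @q0 e0 (a, b)) (@qsrc e0) (Pi u uS).
  exists P'; apply: (key e0) => // [|g]; first by left.
  by rewrite (P'e (fun a b => g (a, b))) sum_prod.
- pose e0 : edge E := exist _ (v, u) uvE.
  have uv : u != v by rewrite eq_sym; exact: (edge_neq e0).
  have [P' [P'0 P'v P'e]] := @resample u v P (p u) (fun a b => q e0 (b, a))
    uv P0 (fun a b => @q0 e0 (b, a)) (@qtgt e0) (Pi u uS).
  exists P'; apply: (key e0) => // [|g]; first by right.
  by rewrite (P'e (fun a b => g (b, a))) exchange_big sum_prod.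
Qed.

Lemma tree_glue : exists P, glued [set: 'I_n]%SET P.
Proof.
have [n0 _ _] := tE.
suff H m : (m < n)%N -> exists S : {set 'I_n}, [/\ (m < #|S|)%N,
    forall i j, i \in S -> j \in S -> connect (inside S) i j
    & exists P, glued S P].
  have /H[S [nS _ [P PS]]] : (n.-1 < n)%N by rewrite prednK.
  exists P; suff <- : S = [set: 'I_n]%SET by [].
  apply/eqP; rewrite eqEcard finset.subsetT cardsT card_ord /=.
  by apply: leq_trans nS; rewrite prednK.
elim: m => [_|m IH mn].
  pose r := Ordinal n0.
  have [P [P0 Pr]] := lift_marginal (@p0 r).
  exists [set r]%SET; split; first by rewrite cards1.
    by move=> i j /set1P -> /set1P ->; exact: connect0.
  exists P; split=> // [i /set1P ->//|e /set1P sr /set1P tr].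
  by have /eqP[] := edge_neq e; rewrite sr tr.
have [S [mS cS [P PS]]] := IH (ltnW mn).
have [mS'|Sm] := ltnP m.+1 #|S|; first by exists S; split => //; exists P.
have [||u [v [uS vS uv]]] := @exit_edge S.
- by rewrite -card_gt0; apply: leq_ltn_trans mS.
- apply: contraTneq mn => ST; rewrite -leqNgt.
  by move: Sm; rewrite ST cardsT card_ord.
exists (v |: S); split; first by rewrite cardsU1 vS.
  exact: connect_grow cS uS uv.
exact: glue_step cS PS uS vS uv.
Qed.

End Tree.
End Gluing.

(** * Measures on finite sets as weights *)

Section Weights.
Variables (R : realType) (T : finPointedType).
Implicit Types (mu nu : {finite_measure set (power T) -> \bar R}).

(** The mass of the point [z]. The argument is a bare set function so that the
same notion applies to measures, probabilities and image measures. *)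
Definition weight (mu : set (power T) -> \bar R) (z : T) : R :=
  fine (mu [set z]).

Lemma weight_ge0 mu z : 0 <= weight mu z.
Proof. exact: fine_ge0. Qed.

Lemma weightE mu z : mu [set z] = (weight mu z)%:E.
Proof. by rewrite fineK //; apply: fin_num_measure. Qed.

Lemma pairing_weight mu (f : T -> R) :
  pairing f mu = (\sum_z weight mu z * f z)%:E.
Proof.
rewrite /pairing.
have int z : mu.-integrable [set: power T]
    (fun x => (f z)%:E * (\1_([set z] : set (power T)) x)%:E)%E.
  by apply: integrableZl => //; exact: integrable_indic.
rewrite (eq_integral (fun x =>
    \sum_(z : T) ((f z)%:E * (\1_([set z] : set (power T)) x)%:E)%E)); last first.
  move=> x _; rewrite (bigD1 x) //= indicE mem_set //= mule1 big1 ?adde0 // => z zx.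
  by rewrite indicE memNset ?mule0 // => /= xz; rewrite xz eqxx in zx.
rewrite integral_sum // -sumEFin; apply: eq_bigr => z _.
rewrite integralZl //; last exact: integrable_indic.
rewrite integral_indic // setIT mulrC EFinM; congr (_ * _)%E.
exact: weightE.
Qed.

Lemma measure_weight mu (A : set (power T)) :
  mu A = (\sum_z weight mu z * (z \in A)%:R)%:E.
Proof.
by rewrite -pairing_weight /pairing integral_indic // setIT.
Qed.

Lemma eq_finite_measure mu nu : weight mu =1 weight nu -> mu = nu.
Proof.
move=> mn; have : mu = nu :> (set (power T) -> \bar R).
  apply/funext => A; rewrite !measure_weight; congr EFin.
  by apply: eq_bigr => z _; rewrite mn.
case: mu nu {mn} => m [[g a] [s] [sf] [si] [fi]] [m' [[g' a'] [s'] [sf'] [si'] [fi']]] /= mm.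
subst m'; rewrite (Prop_irrelevance g' g) (Prop_irrelevance a' a).
rewrite (Prop_irrelevance s' s) (Prop_irrelevance sf' sf).
by rewrite (Prop_irrelevance si' si) (Prop_irrelevance fi' fi).
Qed.

Lemma eq_probability (P Q : probability (power T) R) :
  weight P =1 weight Q -> P = Q.
Proof.
move=> PQ; have : P = Q :> (set (power T) -> \bar R).
  apply/funext => A; rewrite !measure_weight; congr EFin.
  by apply: eq_bigr => z _; rewrite PQ.
case: P Q {PQ} => m [[g a] [s] [sf] [si] [fi] [su] [pr]]
  [m' [[g' a'] [s'] [sf'] [si'] [fi'] [su'] [pr']]] /= mm.
subst m'; rewrite (Prop_irrelevance g' g) (Prop_irrelevance a' a).
rewrite (Prop_irrelevance s' s) (Prop_irrelevance sf' sf).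
rewrite (Prop_irrelevance si' si) (Prop_irrelevance fi' fi).
by rewrite (Prop_irrelevance su' su) (Prop_irrelevance pr' pr).
Qed.

Lemma weight_dirac (x z : T) : weight (dirac (x : power T)) z = (z == x)%:R.
Proof.
rewrite /weight diracE /=; congr (_%:R); congr nat_of_bool; apply/idP/eqP => [|->].
  by rewrite inE /= => ->.
by rewrite inE.
Qed.

End Weights.

Section Marginals.
Variables (R : realType) (T1 T2 : finPointedType).
Implicit Types (mu : Mplus R (T1 * T2)%type).

Lemma weight_marginal1 mu (a : T1) :
  weight (marginal1 mu) a = \sum_b weight mu (a, b).
Proof.
rewrite /weight /marginal1 /pushforward (measure_weight mu) /= sum_prod (bigD1 a) //=.
rewrite [X in _ + X]big1 ?addr0 => [|c ca]; last first.
  rewrite big1 // => b _; rewrite memNset ?mulr0 //= => ac.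
  by rewrite ac eqxx in ca.
by apply: eq_bigr => b _; rewrite mem_set ?mulr1.
Qed.

Lemma weight_marginal2 mu (b : T2) :
  weight (marginal2 mu) b = \sum_a weight mu (a, b).
Proof.
rewrite /weight /marginal2 /pushforward (measure_weight mu) /= sum_prod.
apply: eq_bigr => a _; rewrite (bigD1 b) //= big1 ?addr0 => [|c cb].
  by rewrite mem_set ?mulr1.
rewrite memNset ?mulr0 //= => bc; by rewrite bc eqxx in cb.
Qed.

End Marginals.

(** * The three relaxations *)

(** The criterion applied to each relaxation: [v] is a lower bound on the feasible
set, attained at [x0] and nowhere else. *)
Lemma relaxation_tight (R : realType) (X : Type) (feas : set X)
    (obj : X -> \bar R) (x0 : X) (v : \bar R) :
    feas x0 -> obj x0 = v ->
    (forall y, feas y -> (v <= obj y)%E /\ (obj y = v -> y = x0)) ->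
  minimal_value feas obj v /\ unique_minimizer feas obj x0.
Proof.
move=> fx0 ox0 H.
have m0 : minimizer feas obj x0.
  by split=> // y /H[vy _]; rewrite ox0.
split; first by exists x0.
split=> // y [fy ymin]; have [vy] := H _ fy; apply.
by apply/eqP; rewrite eq_le vy -{1}ox0 ymin.
Qed.

Section Relaxations.
Variables (R : realType) (n : nat) (Omega : 'I_n -> finPointedType).
Variables (E : {set 'I_n * 'I_n}) (f : forall i j : 'I_n, Omega i -> Omega j -> R).
Arguments f : clear implicits.
Variable xstar : config Omega.
Hypothesis hE : edges_once E.
Hypothesis hx : unique_minimizer [set: config Omega] (bivariate_sum E f) xstar.
Notation F := (bivariate_sum E f).

Lemma joint_min (P : config Omega -> R) :
    (forall x, 0 <= P x) -> \sum_x P x = 1 ->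
  F xstar <= \sum_x P x * F x /\
  (\sum_x P x * F x = F xstar -> forall x, P x = (x == xstar)%:R).
Proof.
have [[_ xmin] xuni] := hx.
move=> P0 P1; apply: expectation_min => // x; first exact: xmin.
by move=> xx; apply: xuni; split=> // y _; rewrite xx xmin.
Qed.

(** If [P] is the Dirac weight at [xstar] and [q] is the image of [P] by [g], then
[q] is the Dirac weight at [g xstar]. *)
Lemma pushforward_dirac (P : config Omega -> R) (T : finType)
    (g : config Omega -> T) (q : T -> R) :
    (forall x, P x = (x == xstar)%:R) ->
    (forall h : T -> R, \sum_x P x * h (g x) = \sum_z q z * h z) ->
  forall z, q z = (z == g xstar)%:R.
Proof.
move=> Pd Pq z; have := Pq (fun z' => (z' == z)%:R).
under eq_bigr do rewrite Pd; rewrite sum_pick.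
by under eq_bigr do rewrite mulrC; rewrite sum_pick eq_sym.
Qed.

Lemma sum_weight_probability (T : finPointedType) (mu : Mprob R T) :
  \sum_z weight mu z = 1.
Proof.
apply: EFin_inj; rewrite -(@probability_setT _ _ _ mu) measure_weight; congr EFin.
by apply: eq_bigr => z _; rewrite mem_set ?mulr1.
Qed.

Lemma global_relaxation :
  minimal_value [set: Mprob R (config Omega)] (global_objective E f) (F xstar)%:E /\
  unique_minimizer [set: Mprob R (config Omega)] (global_objective E f)
    (delta1 R xstar).
Proof.
apply: relaxation_tight => // [|mu _].
  rewrite /global_objective pairing_weight; congr EFin.
  under eq_bigr do rewrite weight_dirac.
  exact: sum_pick.
rewrite /global_objective pairing_weight lee_fin.
have [] := joint_min (weight_ge0 mu) (sum_weight_probability mu).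
move=> -> eqmu; split=> // muF.
by apply: eq_probability => x; rewrite (eqmu (EFin_inj muF)) weight_dirac.
Qed.

Lemma bivariate_sum_edges x :
  F x = \sum_(e : edge E) f (src e) (tgt e) (x (src e)) (x (tgt e)).
Proof. exact: (big_sub (mem E) (fun e => f e.1 e.2 (x e.1) (x e.2))). Qed.

Lemma tree_relaxation : is_tree E ->
  minimal_value (@tree_feasible R n Omega E) (tree_objective f) (F xstar)%:E /\
  unique_minimizer (@tree_feasible R n Omega E) (tree_objective f)
    (tree_dirac R E xstar).
Proof.
move=> tE.
have objE v : tree_objective f v =
    (\sum_e \sum_z weight (v.1 e) z * biv f (i := src e) (j := tgt e) z)%:E.
  rewrite /tree_objective -sumEFin; apply: eq_bigr => e _; exact: pairing_weight.
apply: relaxation_tight => // [|v vfeas].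
  rewrite objE bivariate_sum_edges; congr EFin; apply: eq_bigr => e _.
  under eq_bigr do rewrite weight_dirac.
  by rewrite sum_pick.
(* The last two arguments translate feasibility into marginal conditions on
   weights. *)
have [P [P0 Pi Pe]] := @tree_glue R n Omega E hE tE
  (fun i => weight (v.2 i)) (fun e => weight (v.1 e))
  (fun i => weight_ge0 (v.2 i)) (fun e => weight_ge0 (v.1 e))
  (fun e a => etrans (esym (weight_marginal1 (v.1 e) a))
     (congr1 (fun m => weight m a) (esym (vfeas e).1)))
  (fun e b => etrans (esym (weight_marginal2 (v.1 e) b))
     (congr1 (fun m => weight m b) (esym (vfeas e).2))).
have P1 : \sum_x P x = 1.
  have [n0 _ _] := tE; have := Pi (Ordinal n0) (finset.in_setT _) (fun=> 1).
  by rewrite -!mulr_suml !mulr1 => ->; exact: sum_weight_probability.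
have vP : tree_objective f v = (\sum_x P x * F x)%:E.
  rewrite objE; congr EFin.
  under [RHS]eq_bigr do rewrite bivariate_sum_edges mulr_sumr.
  rewrite exchange_big; apply: eq_bigr => e _ /=.
  by rewrite (Pe e _ _ (@biv _ _ _ f _ _)) ?finset.in_setT.
have [Fmin Funi] := joint_min P0 P1.
rewrite vP lee_fin; split=> // PF; have Pd := Funi (EFin_inj PF).
rewrite (surjective_pairing v); congr pair; apply/functional_extensionality_dep.
- move=> e; apply: eq_finite_measure => z; rewrite weight_dirac.
  apply: (pushforward_dirac (g := fun x => (x (src e), x (tgt e))) Pd).
  by apply: Pe; rewrite finset.in_setT.
- move=> i; apply: eq_probability => a; rewrite weight_dirac.
  apply: (pushforward_dirac (g := fun x : config Omega => x i) Pd).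
  by apply: Pi; rewrite finset.in_setT.
Qed.

Lemma star_relaxation (r : 'I_n) : E = out_edges E r ->
  minimal_value (@star_feasible R n Omega E r) (star_objective f (r := r))
    (F xstar)%:E /\
  unique_minimizer (@star_feasible R n Omega E r) (star_objective f (r := r))
    (star_dirac R E r xstar).
Proof.
move=> Er.
have FE x : F x = \sum_(j : leaf E r) f r (val j) (x r) (x (val j)).
  rewrite -(big_sub [pred j | (r, j) \in out_edges E r] (fun j => f r j (x r) (x j))).
  rewrite /bivariate_sum (reindex_onto (fun j => (r, j)) snd) /= => [|[i j]].
    by apply: eq_bigl => j; rewrite eqxx andbT {1}Er.
  by rewrite {1}Er inE /= => /andP[_ /eqP->].
have objE v : star_objective f (r := r) v =
    (\sum_(j : leaf E r) \sum_z weight (v.1 j) z * biv f (i := r) (j := val j) z)%:E.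
  rewrite /star_objective -sumEFin; apply: eq_bigr => j _; exact: pairing_weight.
apply: relaxation_tight => // [|v vfeas].
  rewrite objE FE; congr EFin; apply: eq_bigr => j _.
  under eq_bigr do rewrite weight_dirac.
  by rewrite sum_pick.
have leaf_neq (j : leaf E r) : r != val j.
  by case: j => j /=; rewrite inE => /andP[/hE[]].
(* The last argument translates feasibility into the condition that all the
   edge weights have the same marginal at the root. *)
have [P [P0 Pr Pj]] := @star_glue R n Omega (leaf E r) r val
  (weight v.2) (fun j => weight (v.1 j)) val_inj leaf_neq
  (weight_ge0 v.2) (fun j => weight_ge0 (v.1 j))
  (fun j a => etrans (esym (weight_marginal1 (v.1 j) a))
     (congr1 (fun m => weight m a) (esym (vfeas j)))).
have P1 : \sum_x P x = 1.
  have := Pr (fun=> 1); rewrite -!mulr_suml !mulr1 => ->.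
  exact: sum_weight_probability.
have vP : star_objective f (r := r) v = (\sum_x P x * F x)%:E.
  rewrite objE; congr EFin.
  under [RHS]eq_bigr do rewrite FE mulr_sumr.
  rewrite exchange_big; apply: eq_bigr => j _ /=.
  by rewrite (Pj j (@biv _ _ _ f _ _)).
have [Fmin Funi] := joint_min P0 P1.
rewrite vP lee_fin; split=> // PF; have Pd := Funi (EFin_inj PF).
rewrite (surjective_pairing v); congr pair.
- apply/functional_extensionality_dep => j.
  apply: eq_finite_measure => z; rewrite weight_dirac.
  apply: (pushforward_dirac (g := fun x => (x r, x (val j))) Pd).
  exact: Pj.
- apply: eq_probability => a; rewrite weight_dirac.
  by apply: (pushforward_dirac (g := fun x : config Omega => x r) Pd).
Qed.

End Relaxations.

Theorem mainTheorem5 (R : realType) (n : nat) (Omega : 'I_n -> finPointedType)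
    (E : {set 'I_n * 'I_n}) (f : forall i j : 'I_n, Omega i -> Omega j -> R)
    (xstar : config Omega)
    (hE : edges_once E)
    (hx : unique_minimizer [set: config Omega] (bivariate_sum E f) xstar) :
  [/\ (minimal_value [set: Mprob R (config Omega)] (global_objective E f)
         (bivariate_sum E f xstar)%:E /\
       unique_minimizer [set: Mprob R (config Omega)] (global_objective E f)
         (delta1 R xstar)),
      (is_tree E ->
       minimal_value (@tree_feasible R n Omega E) (tree_objective f)
         (bivariate_sum E f xstar)%:E /\
       unique_minimizer (@tree_feasible R n Omega E) (tree_objective f)
         (tree_dirac R E xstar))
    & (forall istar : 'I_n, is_star E istar -> E = out_edges E istar ->
       minimal_value (@star_feasible R n Omega E istar) (star_objective f (r := istar))
         (bivariate_sum E f xstar)%:E /\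
       unique_minimizer (@star_feasible R n Omega E istar) (star_objective f (r := istar))
         (star_dirac R E istar xstar))].
Proof.
split; first exact: global_relaxation hx.
  exact: tree_relaxation hE hx.
by move=> istar _ Er; apply: (star_relaxation hE hx Er).
Qed.
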